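(* Consider the Kerr metric with $m=1$, $0\le a\le 1$, and put $r_+=1+(1-a^2)^{1/2}$ and $\epsilon=a/r$. If $r\ge 2$, then the Gaussian curvature of $\mathcal S(r)$ is positive. Moreover, there is $\epsilon_0>0$ (independent of $r,a$) such that if $r\ge r_+$ and $\epsilon\le\epsilon_0$, then the Gaussian curvature of $\mathcal S(r)$ is positive.
   Context: $\mathcal S(r)$ is the closed surface $t=\text{constant}$, $r=\text{constant}$ in Kerr spacetime in Boyer-Lindquist coordinates, with the induced metric $d\sigma^2=\Sigma^2d\theta^2+H\,d\varphi^2$ ($0\le\theta\le\pi$, $0\le\varphi<2\pi$), which extends smoothly across the poles $\theta=0,\pi$. Here, with $m=1$, $\Sigma^2=r^2+a^2\cos^2\theta$, $\Delta=r^2-2r+a^2$, $H=\dfrac{\sin^2\theta\left((r^2+a^2)^2-\Delta a^2\sin^2\theta\right)}{\Sigma^2}$, and $r_+$ is the largest root of $\Delta=0$. *)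

(* Defs.v *)
From Stdlib Require Import Reals Lra.
From Coquelicot Require Import Coquelicot.
Open Scope R_scope.

(** * Gaussian curvature of a Riemannian metric on a coordinate patch of R^2 *)

Inductive coord : Set := c1 | c2.

Definition csum (f : coord -> R) : R := f c1 + f c2.

Definition field2 : Type := R -> R -> R.

Definition partial (i : coord) (f : field2) : field2 :=
  fun u v =>
    match i with
    | c1 => Derive (fun x => f x v) u
    | c2 => Derive (fun y => f u y) v
    end.

Definition metric : Type := coord -> coord -> field2.

Definition metric_det (g : metric) : field2 :=
  fun u v => g c1 c1 u v * g c2 c2 u v - g c1 c2 u v * g c2 c1 u v.

Definition metric_inv (g : metric) : metric :=
  fun i j u v =>
    match i, j with
    | c1, c1 => g c2 c2 u v / metric_det g u v
    | c2, c2 => g c1 c1 u v / metric_det g u v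
    | _, _ => - g i j u v / metric_det g u v
    end.

(** [christoffel g k i j] is Gamma^k_{ij}. *)
Definition christoffel (g : metric) (k i j : coord) : field2 :=
  fun u v =>
    / 2 * csum (fun l =>
      metric_inv g k l u v *
      (partial i (g j l) u v + partial j (g i l) u v - partial l (g i j) u v)).

(** [riemann g l k i j] is R^l_{kij}, with the sign convention
    R(d_i, d_j) d_k = nabla_i nabla_j d_k - nabla_j nabla_i d_k
                    = sum_l R^l_{kij} d_l. *)
Definition riemann (g : metric) (l k i j : coord) : field2 :=
  fun u v =>
    partial i (christoffel g l j k) u v - partial j (christoffel g l i k) u v
    + csum (fun m =>
        christoffel g l i m u v * christoffel g m j k u v
        - christoffel g l j m u v * christoffel g m i k u v).

(** K = <R(d_1, d_2) d_2, d_1> / det g *)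
Definition gauss_curvature (g : metric) : field2 :=
  fun u v =>
    csum (fun l => g c1 l u v * riemann g l c2 c1 c2 u v) / metric_det g u v.

(** Pull-back of [g] under the map (u, v) |-> (Phi c1 u v, Phi c2 u v). *)
Definition pullback (g : metric) (Phi : coord -> field2) : metric :=
  fun i j u v =>
    csum (fun k => csum (fun l =>
      g k l (Phi c1 u v) (Phi c2 u v)
      * partial i (Phi k) u v * partial j (Phi l) u v)).

(** * The surfaces S(r) of the Kerr spacetime with m = 1 *)

Definition Sigma2 (a r theta : R) : R := r ^ 2 + a ^ 2 * cos theta ^ 2.

Definition Delta (a r : R) : R := r ^ 2 - 2 * r + a ^ 2.

Definition Hphi (a r theta : R) : R :=
  sin theta ^ 2 * ((r ^ 2 + a ^ 2) ^ 2 - Delta a r * a ^ 2 * sin theta ^ 2)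
  / Sigma2 a r theta.

Definition r_plus (a : R) : R := 1 + sqrt (1 - a ^ 2).

(** Coordinates (theta, phi); degenerate at the poles sin theta = 0. *)
Definition S_metric (a r : R) : metric :=
  fun i j theta _ =>
    match i, j with
    | c1, c1 => Sigma2 a r theta
    | c2, c2 => Hphi a r theta
    | _, _ => 0
    end.

(** The smooth extension of the metric across a pole, in the coordinates
    x = sin theta cos phi, y = sin theta sin phi, which are regular at the
    pole and identify each open hemisphere with the disc x^2 + y^2 < 1 (the
    components are the same on both hemispheres).  With s = x^2 + y^2 the
    metric is  h (dx^2 + dy^2) + q (x dx + y dy)^2,  where
    h = H / sin^2 theta  and  q = (Sigma^2 / cos^2 theta - h) / sin^2 theta;
    the factor s in the denominator of q cancels.  See [pole_metric_pullback]. *)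
Definition pole_Sigma2 (a r s : R) : R := r ^ 2 + a ^ 2 * (1 - s).

Definition pole_h (a r s : R) : R :=
  ((r ^ 2 + a ^ 2) ^ 2 - Delta a r * a ^ 2 * s) / pole_Sigma2 a r s.

Definition pole_q (a r s : R) : R :=
  ((r ^ 2 + a ^ 2) ^ 2 - 2 * (r ^ 2 + a ^ 2) * a ^ 2 + Delta a r * a ^ 2
   + a ^ 2 * (a ^ 2 - Delta a r) * s)
  / (pole_Sigma2 a r s * (1 - s)).

Definition pole_metric (a r : R) : metric :=
  fun i j x y =>
    let s := x ^ 2 + y ^ 2 in
    match i, j with
    | c1, c1 => pole_h a r s + pole_q a r s * x ^ 2
    | c2, c2 => pole_h a r s + pole_q a r s * y ^ 2
    | _, _ => pole_q a r s * (x * y)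
    end.

Definition pole_chart (k : coord) : field2 :=
  fun theta phi =>
    match k with
    | c1 => sin theta * cos phi
    | c2 => sin theta * sin phi
    end.

Lemma pole_metric_pullback (a r theta phi : R) (i j : coord) :
  0 < r -> cos theta <> 0 ->
  pullback (pole_metric a r) pole_chart i j theta phi
  = S_metric a r i j theta phi.
Proof.
intros Hr Hc.
assert (HS : 0 < Sigma2 a r theta).
{ unfold Sigma2; generalize (pow2_ge_0 (a * cos theta)); nra. }
assert (D11 : partial c1 (pole_chart c1) theta phi = cos theta * cos phi).
{ apply is_derive_unique; unfold pole_chart; auto_derive; [easy | ring]. }
assert (D12 : partial c1 (pole_chart c2) theta phi = cos theta * sin phi).
{ apply is_derive_unique; unfold pole_chart; auto_derive; [easy | ring]. }
assert (D21 : partial c2 (pole_chart c1) theta phi = - (sin theta * sin phi)).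
{ apply is_derive_unique; unfold pole_chart; auto_derive; [easy | ring]. }
assert (D22 : partial c2 (pole_chart c2) theta phi = sin theta * cos phi).
{ apply is_derive_unique; unfold pole_chart; auto_derive; [easy | ring]. }
assert (Ep : cos phi ^ 2 = 1 - sin phi ^ 2).
{ generalize (sin2_cos2 phi); unfold Rsqr; lra. }
assert (Et : sin theta ^ 2 = 1 - cos theta ^ 2).
{ generalize (sin2_cos2 theta); unfold Rsqr; lra. }
assert (Es : pole_chart c1 theta phi ^ 2 + pole_chart c2 theta phi ^ 2
             = 1 - cos theta ^ 2).
{ unfold pole_chart; rewrite !Rpow_mult_distr, Ep, Et; ring. }
unfold pullback, csum, pole_metric; cbv zeta; rewrite Es.
assert (HP : pole_Sigma2 a r (1 - cos theta ^ 2) = Sigma2 a r theta).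
{ unfold pole_Sigma2, Sigma2; ring. }
unfold S_metric, Hphi, pole_h, pole_q; rewrite HP, Et.
unfold pole_chart in *.
destruct i, j; rewrite ?D11, ?D12, ?D21, ?D22;
  clear D11 D12 D21 D22 Es HP; unfold Sigma2, Delta in *;
  revert HS Hc Ep Et; generalize (cos theta) (sin theta) (cos phi) (sin phi);
  intros c s p q HS Hc Ep Et;
  (field_simplify_eq; [ring [Ep Et] | repeat split; nra]).
Qed.

(** Gaussian curvature of S(r) at the point with coordinates (theta, phi),
    0 <= theta <= PI; at the two poles it is the curvature of the smooth
    extension. *)
Definition S_gauss_curvature (a r theta phi : R) : R :=
  if Req_EM_T (sin theta) 0
  then gauss_curvature (pole_metric a r) 0 0
  else gauss_curvature (S_metric a r) theta phi.

(* Main.v *)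
(** Put u = cos^2 theta, A = a^2, E = r^2 + A u and
    P = (r^2 + A)^2 - Delta A (1 - u).  Since Sigma^2 H = P sin^2 theta, the
    curvature away from the poles is M / (P^2 E^3), where M is a polynomial in
    r^2, A, Delta and u, homogeneous of degree 6 in the first three.  In terms
    of e = A / r^2 and d = Delta / r^2 it is positive on the box
    0 <= e <= 1/4, 0 <= d, u <= 1, so eps0 = 1/2 works; both r >= 2 and
    r >= r_plus force 0 <= d <= 1, and r >= 2 also forces a / r <= 1/2.  At a
    pole the curvature is (q - 2 dh/ds) / h^2 at s = 0. *)
Require Import Defs.
From Stdlib Require Import Reals.
From Stdlib Require Import Lra.
From Coquelicot Require Import Coquelicot.
(* Reals also exports a [c1]; this restores the coordinate index. *)
Import Defs.
Open Scope R_scope.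

(** * Curvature of diagonal metrics and of rotationally symmetric metrics at the origin *)

Lemma ex_derive_locally_neq (f : R -> R) (x c : R) :
  ex_derive f x -> f x <> c -> locally x (fun t => f t <> c).
Proof.
intros Hf Hc.
apply (ex_derive_continuous (V := R_NormedModule) f x Hf (fun y => y <> c)).
exact (open_neq c (f x) Hc).
Qed.

(** This is the classical [K = - (G' / sqrt (E G))' / (2 sqrt (E G))] for [E du^2 + G dv^2],
    expanded to avoid square roots. Only Gamma^1_22 is differentiated nontrivially: Gamma^1_12
    vanishes identically. *)
Lemma gauss_curvature_diag (g : metric) (E G E' G' : R -> R) (G2 u v : R) :
  (forall x y, g c1 c1 x y = E x) -> (forall x y, g c2 c2 x y = G x) ->
  (forall x y, g c1 c2 x y = 0) -> (forall x y, g c2 c1 x y = 0) ->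
  locally u (fun x => is_derive E x (E' x)) ->
  locally u (fun x => is_derive G x (G' x)) ->
  is_derive G' u G2 -> E u <> 0 -> G u <> 0 ->
  gauss_curvature g u v =
  (G' u ^ 2 / (2 * G u) + E' u * G' u / (2 * E u) - G2) / (2 * (E u * G u)).
Proof.
intros H11 H22 H12 H21 HE HG HG2 E0 G0.
assert (P1 : forall i j x y, partial c2 (g i j) x y = 0).
{ intros i j x y; unfold partial.
  destruct i, j;
    (erewrite Derive_ext; [apply Derive_const | intros t; cbv beta; eauto]). }
assert (P11 : forall x y, partial c1 (g c1 c1) x y = Derive E x).
{ intros x y; apply Derive_ext; intros t; apply H11. }
assert (P22 : forall x y, partial c1 (g c2 c2) x y = Derive G x).
{ intros x y; apply Derive_ext; intros t; apply H22. }
assert (P12 : forall x y, partial c1 (g c1 c2) x y = 0).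
{ intros x y; unfold partial; rewrite (Derive_ext _ (fun _ => 0)); auto using Derive_const. }
assert (P21 : forall x y, partial c1 (g c2 c1) x y = 0).
{ intros x y; unfold partial; rewrite (Derive_ext _ (fun _ => 0)); auto using Derive_const. }
assert (C122 : forall x y, E x <> 0 -> G x <> 0 ->
   christoffel g c1 c2 c2 x y = - Derive G x / (2 * E x)).
{ intros x y Ex Gx; unfold christoffel, csum, metric_inv, metric_det.
  rewrite !P1, P22, H11, H12, H21, H22; field; auto. }
assert (C112 : forall x y, christoffel g c1 c1 c2 x y = 0).
{ intros x y; unfold christoffel, csum, metric_inv, metric_det.
  rewrite !P1, ?P11, ?P12, ?P21, ?P22, H11, H12, H21, H22.
  unfold Rdiv; ring. }
assert (C121 : christoffel g c1 c2 c1 u v = 0).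
{ unfold christoffel, csum, metric_inv, metric_det.
  rewrite !P1, ?P11, ?P12, ?P21, ?P22, H11, H12, H21, H22.
  unfold Rdiv; ring. }
assert (C111 : christoffel g c1 c1 c1 u v = Derive E u / (2 * E u)).
{ unfold christoffel, csum, metric_inv, metric_det.
  rewrite !P1, ?P11, ?P12, ?P21, ?P22, H11, H12, H21, H22; field; auto. }
assert (C212 : christoffel g c2 c1 c2 u v = Derive G u / (2 * G u)).
{ unfold christoffel, csum, metric_inv, metric_det.
  rewrite !P1, ?P11, ?P12, ?P21, ?P22, H11, H12, H21, H22; field; auto. }
assert (D1 : partial c1 (christoffel g c1 c2 c2) u v
             = - G2 / (2 * E u) + G' u * E' u / (2 * E u ^ 2)).
{ unfold partial.
  (* The closed form of Gamma^1_22 requires [E] and [G] nonzero around [u]; continuity supplies this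
     from the values at [u]. *)
  rewrite (Derive_ext_loc _ (fun x => - G' x / (2 * E x))).
  - apply is_derive_unique; auto_derive.
    + repeat split; try lra.
      * exists G2; exact HG2.
      * exists (E' u); exact (locally_singleton _ _ HE).
    + rewrite (is_derive_unique (fun x : R => G' x) u G2 HG2).
      rewrite (is_derive_unique (fun x : R => E x) u (E' u) (locally_singleton _ _ HE)).
      field; auto.
  - assert (HE0 := ex_derive_locally_neq E u 0 (ex_intro (fun l => is_derive E u l) _ (locally_singleton _ _ HE)) E0).
    assert (HG0 := ex_derive_locally_neq G u 0 (ex_intro (fun l => is_derive G u l) _ (locally_singleton _ _ HG)) G0).
    generalize (filter_and _ _ HG (filter_and _ _ HE0 HG0)).
    apply filter_imp; intros x [Hx [Ex Gx]].
    rewrite C122, (is_derive_unique _ _ _ Hx); auto. }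
assert (D2 : partial c2 (christoffel g c1 c1 c2) u v = 0).
{ unfold partial; rewrite (Derive_ext _ (fun _ => 0)); auto using Derive_const. }
assert (EE := is_derive_unique _ _ _ (locally_singleton _ _ HE)).
assert (GG := is_derive_unique _ _ _ (locally_singleton _ _ HG)).
cbv beta in EE, GG.
unfold gauss_curvature, csum at 1, riemann, csum, metric_det.
rewrite D1, D2, C111, C112, C121, C122, C212, EE, GG, H11, H12, H21, H22 by assumption.
field; auto.
Qed.

(** The shape of [pole_metric] with abstract profiles, so that its curvature is computed free of the
    Kerr formulas. *)
Definition radial_metric (h q : R -> R) : metric :=
  fun i j x y =>
    let s := x ^ 2 + y ^ 2 in
    match i, j with
    | c1, c1 => h s + q s * x ^ 2
    | c2, c2 => h s + q s * y ^ 2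
    | _, _ => q s * (x * y)
    end.

(** At the origin Gamma^1_22 and Gamma^1_12 vanish, which kills every quadratic term of R^1_212.
    What remains is d_1 Gamma^1_22 along the x-axis minus d_2 Gamma^1_12 along the y-axis, that is
    [(q - h') / h - h' / h]. *)
Lemma gauss_curvature_radial (h q h' q' : R -> R) (h2 : R) :
  locally 0 (fun s => is_derive h s (h' s)) ->
  locally 0 (fun s => is_derive q s (q' s)) ->
  is_derive h' 0 h2 -> h 0 <> 0 ->
  gauss_curvature (radial_metric h q) 0 0 = (q 0 - 2 * h' 0) / h 0 ^ 2.
Proof.
intros Hh Hq Hh2 h0.
assert (Dh := locally_singleton _ _ Hh); assert (Dq := locally_singleton _ _ Hq).
cbv beta in Dh, Dq.
assert (Eh : ex_derive h 0) by (eexists; exact Dh).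
assert (Eq : ex_derive q 0) by (eexists; exact Dq).
assert (Eh' : ex_derive h' 0) by (eexists; exact Hh2).
assert (sq0 : 0 ^ 2 = 0) by ring.
(* On an axis [s] is the square of the other coordinate and the metric is diagonal with entries [h]
   and [h + q s]; the conditions near [s = 0] are pulled back along [x ^ 2]. *)
assert (Sq : locally 0 (fun x => is_derive h (x ^ 2) (h' (x ^ 2)) /\ ex_derive q (x ^ 2)
   /\ h (x ^ 2) <> 0 /\ h (x ^ 2) + q (x ^ 2) * x ^ 2 <> 0)).
{ assert (L : forall P : R -> Prop, locally 0 P -> locally 0 (fun x => P (x ^ 2))).
  { intros P HP.
    apply (ex_derive_continuous (V := R_NormedModule) (fun x : R => x ^ 2) 0).
    - auto_derive; auto.
    - rewrite sq0; exact HP. }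
  assert (N : locally 0 (fun x => h x + q x * x <> 0)).
  { apply ex_derive_locally_neq; [auto_derive; auto | rewrite Rmult_0_r, Rplus_0_r; exact h0]. }
  generalize (filter_and _ _ (L _ Hh) (filter_and _ _ (L _ Hq)
    (filter_and _ _ (L _ (ex_derive_locally_neq h 0 0 Eh h0)) (L _ N)))).
  apply filter_imp; intros x (A & B & C & D); split; [exact A | split; [eexists; exact B | auto]]. }
set (g := radial_metric h q).
assert (G122 : locally 0 (fun x => christoffel g c1 c2 c2 x 0
   = x * (q (x ^ 2) - h' (x ^ 2)) / (h (x ^ 2) + q (x ^ 2) * x ^ 2))).
{ revert Sq; apply filter_imp; intros x (A & B & C & D).
  assert (Z : x ^ 2 + 0 ^ 2 = x ^ 2) by ring.
  assert (Z' : x * (x * 1) + 0 * (0 * 1) = x ^ 2) by ring.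
  assert (A1 : ex_derive h (x ^ 2)) by (eexists; exact A).
  assert (P1 : partial c2 (g c2 c1) x 0 = q (x ^ 2) * x).
  { apply is_derive_unique; unfold g, radial_metric; auto_derive.
    - rewrite ?Z'; auto.
    - rewrite Z'; ring. }
  assert (P2 : partial c1 (g c2 c2) x 0 = 2 * x * h' (x ^ 2)).
  { apply is_derive_unique; unfold g, radial_metric; auto_derive.
    - rewrite ?Z'; auto.
    - rewrite Z'; rewrite (is_derive_unique (fun s : R => h s) _ _ A); ring. }
  unfold christoffel, csum. rewrite P1, P2.
  unfold metric_inv, metric_det, g, radial_metric; cbv zeta; rewrite Z.
  field; auto. }
assert (G112 : locally 0 (fun y => christoffel g c1 c1 c2 0 y
   = y * h' (y ^ 2) / h (y ^ 2))).
{ revert Sq; apply filter_imp; intros y (A & B & C & D).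
  assert (Z : 0 ^ 2 + y ^ 2 = y ^ 2) by ring.
  assert (Z' : 0 * (0 * 1) + y * (y * 1) = y ^ 2) by ring.
  assert (A1 : ex_derive h (y ^ 2)) by (eexists; exact A).
  assert (P1 : partial c1 (g c2 c1) 0 y = partial c1 (g c1 c2) 0 y) by reflexivity.
  assert (P2 : partial c2 (g c1 c1) 0 y = 2 * y * h' (y ^ 2)).
  { apply is_derive_unique; unfold g, radial_metric; auto_derive.
    - rewrite ?Z'; auto.
    - rewrite Z'; rewrite (is_derive_unique (fun s : R => h s) _ _ A); ring. }
  unfold christoffel, csum. rewrite P1, P2.
  (* These partials need no value: they cancel, or multiply an off-diagonal inverse entry that is
     zero on the axis. *)
  generalize (partial c1 (g c1 c2) 0 y) (partial c1 (g c2 c2) 0 y) (partial c2 (g c1 c2) 0 y).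
  intros p1 p2 p3.
  unfold metric_inv, metric_det, g, radial_metric; cbv zeta; rewrite Z.
  field; auto. }
assert (C122 := locally_singleton _ _ G122); assert (C112 := locally_singleton _ _ G112).
cbv beta in C122, C112; rewrite sq0 in C122, C112.
assert (C121 : christoffel g c1 c2 c1 0 0 = christoffel g c1 c1 c2 0 0).
{ unfold christoffel, csum; change (g c2 c1) with (g c1 c2); ring. }
(* The symbol has the form [x * F x], whose derivative at 0 is [F 0]. *)
assert (D1 : partial c1 (christoffel g c1 c2 c2) 0 0 = (q 0 - h' 0) / h 0).
{ unfold partial; etransitivity; [apply Derive_ext_loc; exact G122 |].
  apply is_derive_unique; auto_derive; rewrite ?Rmult_1_r, ?Rmult_0_l.
  - repeat split; auto. rewrite Rmult_0_r, Rplus_0_r; auto.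
  - field; auto. }
assert (D2 : partial c2 (christoffel g c1 c1 c2) 0 0 = h' 0 / h 0).
{ unfold partial; etransitivity; [apply Derive_ext_loc; exact G112 |].
  apply is_derive_unique; auto_derive; rewrite ?Rmult_1_r, ?Rmult_0_l.
  - repeat split; auto.
  - field; auto. }
unfold gauss_curvature, csum at 1, riemann, csum, metric_det.
rewrite D1, D2, C121, C122, C112.
unfold g, radial_metric; cbv zeta; rewrite !sq0, Rplus_0_r.
field; auto.
Qed.

(** * Positivity of the curvature numerator *)

(* With G = (1 - u) P / E and B = E^2 dG/du, this is E^3 times
   u dP/du dG/du - P dG/du - 2 u P d^2G/du^2. *)
Definition kerr_poly (R2 A D u : R) : R :=
  let E := R2 + A * u in
  let P := (R2 + A) ^ 2 - D * A * (1 - u) in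
  let B := (D * A * (1 - u) - P) * E - (1 - u) * P * A in
  (u * D * A - P) * E * B - 2 * u * P * (- 2 * D * A * E ^ 2 - 2 * A * B).

(** The polynomial is quadratic in [d]. Its constant term is bounded below by Bernoulli's
    inequality, its linear coefficient by discarding nonnegative terms, and its quadratic term by a
    constant multiple of [e ^ 2]. *)
Lemma kerr_poly_scaled_pos (e d u : R) :
  0 <= e <= / 4 -> 0 <= d <= 1 -> 0 <= u <= 1 -> 0 < kerr_poly 1 e d u.
Proof.
intros He Hd Hu.
assert (M0 : (1 + 5 * e) * (1 - 3 * e * u) <= (1 + e) ^ 5 * (1 - 3 * e * u)).
{ apply Rmult_le_compat_r; [nra |].
  replace ((1 + e) ^ 5) with (1 + 5 * e + e ^ 2 * (10 + 10 * e + 5 * e ^ 2 + e ^ 3)) by ring.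
  assert (0 <= e ^ 2) by nra. assert (0 <= e ^ 3) by nra. nra. }
set (m1 := e * (-3 + 6 * u) + e ^ 2 * (-8 + 21 * u - u ^ 2)
   + e ^ 3 * (-7 + 30 * u - 6 * u ^ 2 + u ^ 3)
   + e ^ 4 * (-2 + 21 * u - 9 * u ^ 2 + 2 * u ^ 3)
   + e ^ 5 * (6 * u - 4 * u ^ 2 + u ^ 3)).
set (m2 := (1 - u) * (2 - 4 * u) + e * (1 - u) * (1 - 5 * u) - e ^ 2 * u * (1 - u) * (3 - u)).
(* The bounds below are affine in d, so it suffices to check d = 0 and d = 1. *)
replace (kerr_poly 1 e d u) with ((1 + e) ^ 5 * (1 - 3 * e * u) + d * m1 + d ^ 2 * (e ^ 2 * m2))
  by (unfold kerr_poly, m1, m2; ring).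
assert (Hm1 : - 3 * e - 8 * e ^ 2 - 7 * e ^ 3 - 2 * e ^ 4 + u * (6 * e + 20 * e ^ 2) <= m1).
{ assert (0 <= e ^ 2 * (u * (1 - u))) by (repeat apply Rmult_le_pos; nra).
  assert (0 <= e ^ 3 * (u * (30 - 6 * u + u ^ 2))) by (repeat apply Rmult_le_pos; nra).
  assert (0 <= e ^ 4 * (u * (21 - 9 * u + 2 * u ^ 2))) by (repeat apply Rmult_le_pos; nra).
  assert (0 <= e ^ 5 * (u * (6 - 4 * u + u ^ 2))) by (repeat apply Rmult_le_pos; nra).
  unfold m1; nra. }
(* The two quadratics in [u] are smallest at 3/4 and 3/5, with values -1/4 and -4/5. The three
   bounds add up to -9/16. *)
assert (Hm2 : - 6 / 10 <= m2).
{ assert (T1 : - / 4 <= (1 - u) * (2 - 4 * u)) by (generalize (pow2_ge_0 (u - 3 / 4)); lra).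
  assert (T2 : - / 4 <= e * ((1 - u) * (1 - 5 * u))).
  { assert (W : - (4 / 5) <= (1 - u) * (1 - 5 * u))
      by (generalize (pow2_ge_0 (u - 3 / 5)); lra).
    generalize (Rmult_le_compat_l e _ _ (proj1 He) W); lra. }
  assert (T3 : e ^ 2 * (u * (1 - u) * (3 - u)) <= 1 / 16).
  { assert (e ^ 2 <= 1 / 16) by nra. assert (0 <= e ^ 2) by nra.
    assert (u * (1 - u) * (3 - u) <= 1) by nra.
    assert (0 <= u * (1 - u) * (3 - u)) by (repeat apply Rmult_le_pos; lra). nra. }
  unfold m2; nra. }
assert (He2 : 0 <= e ^ 2 <= / 16) by nra.
assert (He3 : 0 <= e ^ 3 <= / 64) by (replace (e ^ 3) with (e * e ^ 2) by ring; nra).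
assert (He4 : 0 <= e ^ 4 <= / 256) by (replace (e ^ 4) with (e * e ^ 3) by ring; nra).
assert (Hm2' : - 6 / 10 * e ^ 2 <= d ^ 2 * (e ^ 2 * m2)).
{ assert (0 <= d ^ 2 <= 1) by nra. assert (0 <= d ^ 2 * e ^ 2 <= e ^ 2) by nra.
  replace (d ^ 2 * (e ^ 2 * m2)) with (d ^ 2 * e ^ 2 * m2) by ring. nra. }
set (n1 := - 3 * e - 8 * e ^ 2 - 7 * e ^ 3 - 2 * e ^ 4 + u * (6 * e + 20 * e ^ 2)) in *.
assert (Hn : d * n1 <= d * m1) by nra.
set (n0 := (1 + 5 * e) * (1 - 3 * e * u) - 6 / 10 * e ^ 2).
(* At [d = 0] the bound is nonincreasing in [u], so [u = 1] is the worst case; at [d = 1] it is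
   nondecreasing, so [u = 0] is. *)
assert (N0 : 0 < n0).
{ assert ((1 + 5 * e) * (1 - 3 * e) <= (1 + 5 * e) * (1 - 3 * e * u)) by nra.
  unfold n0; lra. }
assert (N1 : 0 < n0 + n1).
{ assert (0 <= u * (3 * e + 5 * e ^ 2)) by (apply Rmult_le_pos; nra).
  unfold n0, n1; lra. }
assert (0 < n0 + d * n1) by (clearbody n0 n1; destruct (Rle_dec 0 n1); nra).
unfold n0 in *; lra.
Qed.

Lemma kerr_poly_pos (R2 A D u : R) :
  0 < R2 -> 0 <= A -> 4 * A <= R2 -> 0 <= D <= R2 -> 0 <= u <= 1 ->
  0 < kerr_poly R2 A D u.
Proof.
intros HR HA HAR HD Hu.
replace (kerr_poly R2 A D u) with (R2 ^ 6 * kerr_poly 1 (A / R2) (D / R2) u)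
  by (unfold kerr_poly; field; lra).
apply Rmult_lt_0_compat; [apply pow_lt; lra |].
apply kerr_poly_scaled_pos; auto; split.
- apply Rdiv_le_0_compat; lra.
- apply (Rle_div_l A (/ 4) R2); lra.
- apply Rdiv_le_0_compat; lra.
- apply (Rle_div_l D 1 R2); lra.
Qed.

(** * Positivity of the curvature at regular points and at the poles *)

Lemma S_gauss_curvature_regular_pos (a r theta phi : R) :
  0 < r -> 0 <= 2 * a <= r -> 0 <= Delta a r <= r ^ 2 -> sin theta <> 0 ->
  0 < gauss_curvature (S_metric a r) theta phi.
Proof.
intros Hr Ha HD Hs.
set (A := a ^ 2); set (D := Delta a r) in *.
assert (HA : 0 <= A /\ 4 * A <= r ^ 2) by (unfold A; nra).
assert (Hr2 : 0 < r ^ 2) by nra.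
set (u t := cos t ^ 2).
assert (Es : forall t, sin t ^ 2 = 1 - u t).
{ intros t; generalize (sin2_cos2 t); unfold u, Rsqr; lra. }
assert (Hu : forall t, 0 <= u t <= 1).
{ intros t; generalize (Es t) (pow2_ge_0 (sin t)) (pow2_ge_0 (cos t)); fold (u t); lra. }
set (E v := r ^ 2 + A * v).
set (P v := (r ^ 2 + A) ^ 2 - D * A * (1 - v)).
set (B v := (D * A * (1 - v) - P v) * E v - (1 - v) * P v * A).
assert (HE : forall t, 0 < E (u t)) by (intros t; generalize (Hu t); unfold E; nra).
assert (HP : forall t, 0 < P (u t)).
{ intros t.
  assert (D * A <= r ^ 2 * A) by nra. assert (0 <= D * A) by nra.
  assert (D * A * (1 - u t) <= D * A) by (generalize (Hu t); nra).
  unfold P; nra. }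
assert (HS2 : forall t, Sigma2 a r t = E (u t)) by reflexivity.
assert (HH : forall t, Hphi a r t = (1 - u t) * P (u t) / E (u t)).
{ intros t; unfold Hphi; rewrite Es; reflexivity. }
(* First and second derivatives of [(1 - v) * P v / E v], using [dB/dv = - 2 D A E]. The chain rule
   with [du/dtheta = - 2 cos theta sin theta] turns them into the derivatives of [Hphi]. *)
set (G1 v := B v / E v ^ 2).
set (G2 v := - 2 * D * A / E v - 2 * A * B v / E v ^ 3).
assert (Hu1 : 1 - u theta <> 0).
{ rewrite <- Es; apply pow_nonzero, Hs. }
rewrite (gauss_curvature_diag _ (Sigma2 a r) (Hphi a r)
  (fun t => - 2 * cos t * sin t * A)
  (fun t => - 2 * cos t * sin t * G1 (u t))
  (4 * cos theta ^ 2 * sin theta ^ 2 * G2 (u theta)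
   + 2 * (sin theta ^ 2 - cos theta ^ 2) * G1 (u theta)));
  try reflexivity.
- replace (_ / _) with (kerr_poly (r ^ 2) A D (u theta) / (P (u theta) ^ 2 * E (u theta) ^ 3)).
  { apply Rdiv_lt_0_compat; [apply kerr_poly_pos; auto; lra |].
    apply Rmult_lt_0_compat; apply pow_lt; auto. }
  rewrite HS2, HH.
  (* Once these products are written in [u], the claim is a rational identity in one variable. *)
  replace (- 2 * cos theta * sin theta * A * (- 2 * cos theta * sin theta * G1 (u theta)))
    with (4 * A * (u theta * (1 - u theta)) * G1 (u theta)) by (rewrite <- Es; unfold u; ring).
  replace ((- 2 * cos theta * sin theta * G1 (u theta)) ^ 2)
    with (4 * (u theta * (1 - u theta)) * G1 (u theta) ^ 2) by (rewrite <- Es; unfold u; ring).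
  rewrite Es; change (cos theta ^ 2) with (u theta).
  assert (E1 := Rgt_not_eq _ _ (HE theta)); assert (P1 := Rgt_not_eq _ _ (HP theta)).
  revert E1 P1 Hu1; generalize (u theta); intros v E1 P1 Hu1.
  unfold kerr_poly, G1, G2, B, P, E in *; field; auto.
- apply filter_forall; intros t; unfold Sigma2, A; auto_derive; [easy | ring].
- apply filter_forall; intros t.
  assert (Et := HE t); assert (Est := Es t).
  unfold Hphi, Sigma2; auto_derive.
  + unfold E, A, u in Et; simpl in Et |- *; lra.
  + unfold G1, B, P, E, u, A, D in *.
    revert Et Est; generalize (cos t) (sin t) (Delta a r).
    intros c s d Et Est; field_simplify_eq; [ring [Est] | lra].
- assert (Et := HE theta); assert (Est := Es theta).
  unfold G1, G2, B, P, E, u in *; auto_derive.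
  + simpl in Et |- *; nra.
  + revert Et Est; generalize (cos theta) (sin theta).
    intros c s Et Est; field_simplify_eq; [ring [Est] | lra].
- rewrite HS2; apply Rgt_not_eq, HE.
- rewrite HH; apply Rgt_not_eq.
  generalize (HE theta) (HP theta) (proj2 (Hu theta)); intros.
  apply Rdiv_lt_0_compat; auto; apply Rmult_lt_0_compat; auto; lra.
Qed.

Lemma S_gauss_curvature_pole_pos (a r : R) :
  0 < r -> 0 <= 2 * a <= r -> 0 <= Delta a r <= r ^ 2 ->
  0 < gauss_curvature (pole_metric a r) 0 0.
Proof.
intros Hr Ha HD.
set (A := a ^ 2); set (D := Delta a r) in *.
assert (HA : 0 <= A /\ 4 * A <= r ^ 2) by (unfold A; nra).
assert (Hr2 : 0 < r ^ 2) by nra.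
set (E s := r ^ 2 + A * (1 - s)).
set (N s := (r ^ 2 + A) ^ 2 - 2 * (r ^ 2 + A) * A + D * A + A * (A - D) * s).
assert (L : locally 0 (fun s => E s <> 0 /\ 1 - s <> 0)).
{ apply filter_and.
  - apply ex_derive_locally_neq; [unfold E; auto_derive; auto | unfold E; lra].
  - apply ex_derive_locally_neq; [auto_derive; auto | lra]. }
change (pole_metric a r) with (radial_metric (pole_h a r) (pole_q a r)).
rewrite (gauss_curvature_radial (pole_h a r) (pole_q a r)
  (fun s => (((r ^ 2 + A) ^ 2 - D * A * s) * A - D * A * E s) / E s ^ 2)
  (fun s => (A * (A - D) * (E s * (1 - s)) + N s * (E s + A * (1 - s))) / (E s * (1 - s)) ^ 2)
  (2 * A * (((r ^ 2 + A) ^ 2) * A - D * A * E 0) / E 0 ^ 3)).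
- replace (_ / _) with
    ((r ^ 4 - 2 * r ^ 2 * A - 3 * A ^ 2 + 3 * D * A) * (r ^ 2 + A) / (r ^ 2 + A) ^ 4).
  { apply Rdiv_lt_0_compat; [apply Rmult_lt_0_compat |apply pow_lt]; try lra.
    (* The factor equals [(r^2 - 3 A) (r^2 + A) + 3 D A], positive because [4 A <= r^2]. *)
    replace (r ^ 4) with (r ^ 2 * r ^ 2) by ring; nra. }
  unfold pole_q, pole_h, pole_Sigma2, E; fold A D; field; lra.
- revert L; apply filter_imp; intros s [H1 H2].
  unfold pole_h, pole_Sigma2; fold A D; unfold E in *; auto_derive; [auto |field; auto].
- revert L; apply filter_imp; intros s [H1 H2].
  unfold pole_q, pole_Sigma2; fold A D; unfold N, E in *; auto_derive; [auto |field; auto].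
- unfold E; auto_derive; [| field; lra].
  apply Rgt_not_eq; repeat apply Rmult_lt_0_compat; lra.
- unfold pole_h, pole_Sigma2; fold A D; apply Rgt_not_eq, Rdiv_lt_0_compat; nra.
Qed.

(** * The two ranges of radii *)

Theorem theorem3p1 :
  (forall a r : R, 0 <= a <= 1 -> 2 <= r ->
     forall theta phi : R, 0 <= theta <= PI -> 0 <= phi < 2 * PI ->
       0 < S_gauss_curvature a r theta phi)
  /\
  (exists eps0 : R, 0 < eps0 /\
     forall a r : R, 0 <= a <= 1 -> r_plus a <= r -> a / r <= eps0 ->
     forall theta phi : R, 0 <= theta <= PI -> 0 <= phi < 2 * PI ->
       0 < S_gauss_curvature a r theta phi).
Proof.
assert (K : forall a r theta phi, 0 < r -> 0 <= 2 * a <= r -> 0 <= Delta a r <= r ^ 2 ->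
  0 < S_gauss_curvature a r theta phi).
{ intros a r theta phi Hr Ha HD; unfold S_gauss_curvature.
  destruct (Req_EM_T (sin theta) 0).
  - apply S_gauss_curvature_pole_pos; assumption.
  - apply S_gauss_curvature_regular_pos; assumption. }
split.
(* Here [Delta = r (r - 2) + a^2 >= 0], and [a^2 <= 2 r] gives [Delta <= r^2]. *)
- intros a r Ha Hr theta phi _ _; apply K; unfold Delta; [lra | lra | split; nra].
- exists (/ 2); split; [lra |].
  intros a r Ha Hr He theta phi _ _; unfold r_plus in Hr.
  assert (S0 := sqrt_pos (1 - a ^ 2)).
  assert (S1 : sqrt (1 - a ^ 2) ^ 2 = 1 - a ^ 2) by (apply pow2_sqrt; nra).
  apply Rle_div_l in He; [| lra].
  (* Since [Delta = (r - 1)^2 - (1 - a^2)], squaring [r - 1 >= sqrt (1 - a^2)] gives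
     [Delta >= 0]. *)
  assert (S2 : sqrt (1 - a ^ 2) ^ 2 <= (r - 1) ^ 2) by (apply pow_incr; lra).
  apply K; unfold Delta; [lra | lra | split; nra].
Qed.
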